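(* Assume $a,b\in C^1(\mathbb{R})$ with $a>0$ everywhere, and that there is $\bar u<1$ with $$-\infty<\inf_{\mathbb{R}} b<\inf_{u\ge \bar u} b(u).$$ For each $T>0$ let $u_T$ be a minimizer of $F_T$ over $U_T$ (minimization without any contact constraint). Then there is a constant $c>0$, independent of $T$, such that for all $T>0$ $$\bigl|\{x\in[0,T]: u_T(x)\ge \bar u\}\bigr|\le c\,(1+\sqrt T),$$ where $|\cdot|$ denotes Lebesgue measure.
   Context: For $T>0$, $U_T=\{1+v: v\in H^1_0(0,T)\}$ (functions in $H^1(0,T)$ equal to $1$ at $0$ and $T$), and $F_T(u)=\int_0^T\bigl[a(u)(u')^2+b(u)\bigr]\,dx$ for $u\in U_T$. *)

(* Defs.v *)
From HB Require Import structures.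
From mathcomp Require Import all_boot all_order all_algebra.
From mathcomp Require Import all_classical all_reals all_analysis.
Set Implicit Arguments. Unset Strict Implicit. Unset Printing Implicit Defensive.
Import Order.TTheory GRing.Theory Num.Theory numFieldNormedType.Exports.
Local Open Scope classical_set_scope.
Local Open Scope ring_scope.

Definition I0 {R : realType} (T : R) : set R := `[0, T].

Definition C1 {R : realType} (f : R -> R) : Prop :=
  (forall x : R, derivable f x 1) /\ continuous (derive1 f).

(* [inUT T u g] : u belongs to U_T = 1 + H^1_0(0,T), and g is (a representative
   of) its weak derivative on (0,T).  One-dimensional H^1 functions are exactly
   the absolutely continuous ones, u(x) = u(0) + \int_0^x u', with u' in L^2. *)
Definition inUT {R : realType} (T : R) (u g : R -> R) : Prop :=
  measurable_fun `[0, T] g /\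
  (\int[lebesgue_measure]_(x in I0 T) ((g x) ^+ 2)%:E < +oo)%E /\
  (forall x, 0 <= x <= T ->
     u x = 1 + Rintegral lebesgue_measure `[0, x] g) /\
  u T = 1.

Definition FT {R : realType} (a b : R -> R) (T : R) (u g : R -> R) : \bar R :=
  (\int[lebesgue_measure]_(x in I0 T) (a (u x) * (g x) ^+ 2 + b (u x))%:E)%E.

Definition minimizerFT {R : realType} (a b : R -> R) (T : R) (u : R -> R) : Prop :=
  exists g, inUT T u g /\
    forall v h, inUT T v h -> (FT a b T u g <= FT a b T v h)%E.

(* Main.v *)
(** Let [z < ubar] minimize [b] over [[z0, ubar]], where [b z0] lies below the
    infimum of [b] on [[ubar, +oo[]; then [b >= b z] on [[z, +oo[], with a gap
    on [[ubar, +oo[].  Compare a minimizer [u] with the trapezoid [w] that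
    descends from 1 to [z] on [[0, 1]], rests at [z], and climbs back to 1 on
    [[T - 1, T]].  On a component of [{u > w}], replacing [u] by [w] gains the
    gap times the time spent above [ubar] and costs a fixed amount per unit of
    time on the two ramps.  A component that avoids the ramps therefore spends
    no time above [ubar]; each of the others contains [1] or [T - 1], so there
    are at most two of them and the measure is bounded by a constant. *)

Require Import Defs.
From HB Require Import structures.
From mathcomp Require Import all_boot all_order all_algebra.
From mathcomp Require Import all_classical all_reals all_analysis.
From mathcomp Require Import measurable_realfun ring lra.
Import Order.TTheory GRing.Theory Num.Theory numFieldNormedType.Exports.
Local Open Scope classical_set_scope.
Local Open Scope ring_scope.

(** * Zeros of a continuous function on either side of a point of positivity *)

Lemma within_continuous_dist {R : realType} (T : R) (f : R -> R) :
  {within `[0, T], continuous f} ->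
  forall x, 0 <= x <= T -> forall e, 0 < e ->
  exists2 d, 0 < d & forall y, 0 <= y <= T -> `|x - y| < d -> `|f x - f y| < e.
Proof.
move=> /subspace_continuousP cf x xT e e0.
have xI : `[0, T]%classic x by rewrite /= in_itv.
have /(_ _ (nbhsx_ballx (f x) e e0)) := cf x xI.
move=> /nbhs_ballP[d /= d0 dP].
by exists d => // y yT xy; apply: dP => //=; rewrite in_itv.
Qed.

(** The zero is the supremum of the points of [[0, y]] where [p <= 0]. It is a limit of such points,
    so [p] cannot be positive there. Were [p] negative there, the supremum would lie strictly before
    [y], and [p] would be positive at points arbitrarily close on its right, against continuity. *)
Lemma last_zero_before {R : realType} (T y : R) (p : R -> R) :
  {within `[0, T], continuous p} -> p 0 = 0 -> 0 <= y <= T -> 0 < p y ->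
  exists2 al, 0 <= al < y & p al = 0 /\ forall x, al < x <= y -> 0 < p x.
Proof.
move=> /within_continuous_dist cp p0 /andP[y0 yT] py.
pose A := [set x | 0 <= x <= y /\ p x <= 0].
have A0 : A 0 by split; rewrite ?p0 ?lexx.
have supA : has_sup A by split; [exists 0|exists y => x [/andP[]]].
have sup0 : 0 <= sup A by apply: sup_ubound => //; case: supA.
have supy : sup A <= y by apply: ge_sup => [|x [/andP[]]//]; exists 0.
have pos x : sup A < x <= y -> 0 < p x.
  move=> /andP[sx xy]; rewrite ltNge; apply/negP => px.
  have /(ub_le_sup supA.2) : A x.
    by split => //; rewrite xy andbT (le_trans sup0)// ltW.
  by rewrite leNgt sx.
have sT : 0 <= sup A <= T by rewrite sup0 (le_trans supy).
have ps : p (sup A) = 0.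
  apply/eqP; rewrite eq_le; apply/andP; split; rewrite leNgt; apply/negP => ps.
    have [d d0 dP] := cp _ sT _ ps.
    have [x [/andP[x0 xy] px] dx] := sup_adherent d0 supA.
    have xs : x <= sup A by apply: ub_le_sup; [case: supA|split => //; apply/andP].
    have := dP x _ _.
    rewrite x0 (le_trans xy yT) => /(_ isT).
    rewrite ger0_norm ?subr_ge0// => H.
    have {H} : `|p (sup A) - p x| < p (sup A) by apply: H; lra.
    by rewrite ger0_norm; lra.
  have [d d0 dP] := cp (sup A) sT (- p (sup A)) ltac:(by rewrite oppr_gt0).
  have sy : sup A < y.
    by rewrite lt_neqAle supy andbT; apply/eqP => E; move: ps; rewrite E; lra.
  pose x := Num.min y (sup A + d / 2).
  have sx : sup A < x by rewrite lt_min sy; lra.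
  have xy : x <= y by rewrite ge_min lexx.
  have xd : x <= sup A + d / 2 by rewrite ge_min lexx orbT.
  have px : 0 < p x by apply: pos; rewrite sx.
  have := dP x _ _; rewrite ler0_norm ?subr_le0; last exact: ltW.
  move=> /(_ ltac:(by lra) ltac:(by lra)).
  by rewrite ler0_norm; lra.
exists (sup A); last by [].
rewrite sup0 /= lt_neqAle supy andbT; apply/eqP => E.
by move: py; rewrite -E ps ltxx.
Qed.

(** Mirror image of [last_zero_before] under the reflection [x] to [T - x]. Together the two lemmas
    yield the component of [p > 0] around [y]. *)
Lemma first_zero_after {R : realType} (T y : R) (p : R -> R) :
  {within `[0, T], continuous p} -> p T = 0 -> 0 <= y <= T -> 0 < p y ->
  exists2 be, y < be <= T & p be = 0 /\ forall x, y <= x < be -> 0 < p x.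
Proof.
move=> cp pT /andP[y0 yT] py.
have cq : {within `[0, T], continuous (fun x => p (T - x))}.
  have dcp := within_continuous_dist _ _ cp.
  apply/subspace_continuousP => x; rewrite /= in_itv /= => xT.
  apply/cvgrPdist_lt => e e0.
  have xT' : 0 <= T - x <= T by lra.
  have [d d0 dP] := dcp _ xT' e e0.
  apply/nbhs_ballP; exists d => // z /= xz; rewrite in_itv /= => zT.
  apply: dP; first by lra.
  by rewrite opprB addrC addrA subrK distrC.
have q0 : p (T - 0) = 0 by rewrite subr0.
have qy : 0 < p (T - (T - y)) by rewrite subKr.
have yT' : 0 <= T - y <= T by lra.
have [al /andP[al0 aly] [pal pos]] := last_zero_before T (T - y) _ cq q0 yT' qy.
exists (T - al); first by lra.
split=> // x xbe; rewrite -(subKr T x); apply: pos; lra.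
Qed.

(** * Integrability, continuity and splicing in the admissible class *)

Lemma square_integrable {R : realType} (T : R) (g : R -> R) :
  measurable_fun `[0, T] g ->
  (\int[lebesgue_measure]_(x in I0 T) ((g x) ^+ 2)%:E < +oo)%E ->
  lebesgue_measure.-integrable `[0, T] (EFin \o (fun x => g x ^+ 2)).
Proof.
move=> mg g2; apply/integrableP; split.
  by apply/measurable_EFinP; exact: measurable_funX.
by under eq_integral do rewrite /= ger0_norm ?sqr_ge0//.
Qed.

Lemma itv_integrable_cst {R : realType} (s t r : R) :
  lebesgue_measure.-integrable `[s, t] (EFin \o (fun=> r)).
Proof.
apply: measurable_bounded_integrable => //.
  by apply: compact_finite_measure; exact: segment_compact.
exists `|r|; split => // x rx y _ /=; exact: ltW.
Qed.

(** On a bounded interval L^2 is contained in L^1, because [|g| <= g ^+ 2 + 1]. *)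
Lemma square_integrable_integrable {R : realType} (T : R) (g : R -> R) :
  measurable_fun `[0, T] g ->
  (\int[lebesgue_measure]_(x in I0 T) ((g x) ^+ 2)%:E < +oo)%E ->
  lebesgue_measure.-integrable `[0, T] (EFin \o g).
Proof.
move=> mg g2.
have i2 := square_integrable T g mg g2.
apply: (le_integrable _ _ _ (integrableD _ i2 (itv_integrable_cst 0 T 1))) => //.
  exact/measurable_EFinP.
move=> x _; suff : `|g x| <= `|g x ^+ 2 + 1| by rewrite -lee_fin.
rewrite (ger0_norm (_ : 0 <= g x ^+ 2 + 1)); last by rewrite addr_ge0// sqr_ge0.
rewrite -(real_normK (num_real (g x))).
have := sqr_ge0 (`|g x| - 1); have := normr_ge0 (g x); nra.
Qed.

Lemma inUT_integrable {R : realType} (T : R) (u g : R -> R) : inUT T u g ->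
  lebesgue_measure.-integrable `[0, T] (EFin \o g).
Proof. by move=> [mg [g2 _]]; exact: (square_integrable_integrable T g). Qed.

Lemma inUT_left {R : realType} (T : R) (u g : R -> R) :
  0 <= T -> inUT T u g -> u 0 = 1.
Proof.
move=> T0 [_ [_ [uE _]]]; rewrite uE ?lexx//.
by rewrite set_itv1 Rintegral_set1 addr0.
Qed.

Lemma inUT_continuous {R : realType} (T : R) (u g : R -> R) :
  0 <= T -> inUT T u g -> {within `[0, T], continuous u}.
Proof.
move=> T0 ug; have ig := inUT_integrable T u g ug.
have [_ [_ [uE _]]] := ug.
have /within_continuous_dist ci := parameterized_integral_continuous T0 ig.
apply/subspace_continuousP => x; rewrite /= in_itv /= => xT.
apply/cvgrPdist_lt => e e0.
have [d d0 dP] := ci x xT e e0.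
apply/nbhs_ballP; exists d => // z /= xz; rewrite in_itv /= => zT.
have := dP z zT xz; rewrite /parameterized_integral => H.
change (`|u x - u z| < e); rewrite uE// uE//.
by move: H; rewrite opprD addrACA subrr add0r.
Qed.

Lemma inUT_increment {R : realType} (T s t : R) (u g : R -> R) :
  inUT T u g -> 0 <= s -> s <= t -> t <= T ->
  Rintegral lebesgue_measure `[s, t] g = u t - u s.
Proof.
move=> ug s0 st tT; have ig := inUT_integrable T u g ug.
have [_ [_ [uE _]]] := ug.
have t0 := le_trans s0 st; have sT := le_trans st tT.
have i0t : lebesgue_measure.-integrable `[0, t] (EFin \o g).
  by apply: integrableS ig => //; apply: subset_itvl; rewrite bnd_simp.
rewrite uE ?t0// uE ?s0// opprD addrACA subrr add0r.
rewrite (Rintegral_itvB i0t) ?bnd_simp//.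
rewrite Rintegral_itv_obnd_cbnd//.
by apply: integrableS i0t => //; apply: subset_itv; rewrite bnd_simp.
Qed.

(** Provides the competitor that modifies a minimizer on a single excursion, so that minimality can
    be exploited one component at a time. *)
Lemma inUT_splice {R : realType} (T al be : R) (u g w k : R -> R) :
  0 <= al -> al <= be -> be <= T -> inUT T u g -> inUT T w k ->
  u al = w al -> u be = w be ->
  inUT T (fun x => if al <= x <= be then w x else u x)
         (fun x => if al <= x <= be then k x else g x).
Proof.
move=> al0 albe beT ug wk ual ube.
have [mg [g2 [uE uT]]] := ug; have [mk [k2 [_ wT]]] := wk.
have ig := inUT_integrable T u g ug; have ik := inUT_integrable T w k wk.
pose q x := k x - g x.
have iq : lebesgue_measure.-integrable `[0, T] (EFin \o q).
  exact: (integrableB _ ik ig).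
(* The splice only perturbs [g] by [q] on [[al, be]], and the integral of [q]
   over [[al, be]] vanishes since [u] and [w] agree at both ends. *)
have hE : (fun x => if al <= x <= be then k x else g x) =
    (fun x => g x + (q \_ `[al, be]) x).
  apply/funext => x; rewrite patchE mem_setE in_itv /=.
  by case: ifP => _; rewrite ?addr0// /q addrC subrK.
have sA : `[al, be] `<=` `[0, T].
  by apply: subset_itv; rewrite bnd_simp.
have mq : measurable_fun `[0, T] (q \_ `[al, be]).
  apply/measurable_restrict => //; apply: measurable_funS (measurable_funB mk mg) => //.
have mh : measurable_fun `[0, T] (fun x => if al <= x <= be then k x else g x).
  by rewrite hE; exact: measurable_funD.
have iqA (A : set R) : measurable A -> A `<=` `[0, T] ->
    lebesgue_measure.-integrable A (EFin \o (q \_ `[al, be])).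
  move=> mA AT.
  have iqS : lebesgue_measure.-integrable A (EFin \o q) by exact: integrableS iq.
  apply: (le_integrable _ _ _ iqS) => //.
    by apply/measurable_EFinP; apply: measurable_funS mq.
  move=> x _ /=; rewrite lee_fin patchE; case: ifP => // _.
  by rewrite normr0 normr_ge0.
split=> //; split.
  have i2 : lebesgue_measure.-integrable `[0, T]
      (EFin \o (fun x => g x ^+ 2 + k x ^+ 2)).
    by apply: (integrableD _ (square_integrable T g mg g2)
                             (square_integrable T k mk k2)).
  have /integrableP[_] : lebesgue_measure.-integrable `[0, T]
     (EFin \o (fun x => (if al <= x <= be then k x else g x) ^+ 2)).
    apply: (le_integrable _ _ _ i2) => //.
      by apply/measurable_EFinP; exact: measurable_funX.
    move=> x _; set h := fun x => _.
    suff : `|h x| <= `|g x ^+ 2 + k x ^+ 2| by rewrite -lee_fin.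
    rewrite !ger0_norm ?sqr_ge0// ?addr_ge0 ?sqr_ge0// /h.
    by case: ifP => _; rewrite ?lerDr ?lerDl sqr_ge0.
  by under eq_integral do rewrite /= ger0_norm ?sqr_ge0//.
split; last by case: ifP => // _; rewrite wT.
move=> x /andP[x0 xT]; rewrite hE.
have sx : `[0, x] `<=` `[0, T] by apply: subset_itvl; rewrite bnd_simp.
rewrite RintegralD//; last 2 first.
- exact: integrableS ig.
- exact: iqA.
rewrite addrA -uE ?x0// -Rintegral_mkcondr.
have [alx|xal] := leP al x; last first.
  rewrite (_ : _ `&` _ = set0) ?Rintegral_set0 ?addr0//.
  apply/seteqP; split => y //= []; rewrite !in_itv /= => /andP[_ yx] /andP[aly _].
  by move: (le_lt_trans yx xal); rewrite ltNge aly.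
(* Up to [x], the perturbation has acted on [[al, y]] only, and its integral there is [w y - u y]
   because [u al = w al]. For [x <= be] this turns [u x] into [w x]; past [be] it is
   [w be - u be = 0]. *)
pose y := Num.min x be.
have yx : y <= x by rewrite ge_min lexx.
have ybe : y <= be by rewrite ge_min lexx orbT.
have aly : al <= y by rewrite le_min alx.
rewrite (_ : _ `&` _ = `[al, y]%classic); last first.
  apply/seteqP; split => t /=.
    rewrite !in_itv /= => -[/andP[_ tx] /andP[alt tbe]].
    by rewrite alt le_min tx tbe.
  rewrite !in_itv /= => /andP[alt ty].
  by rewrite alt (le_trans ty ybe) (le_trans al0 alt) (le_trans ty yx).
have yT := le_trans ybe beT.
have sy : `[al, y] `<=` `[0, T] by apply: subset_itv; rewrite bnd_simp.
rewrite /q RintegralB//; last 2 first.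
- exact: integrableS ik.
- exact: integrableS ig.
rewrite (inUT_increment T _ _ w)// (inUT_increment T _ _ u)// ual.
rewrite opprB [_ + (w al - _)]addrA subrK.
rewrite /= /y; case: (leP x be) => xbe; first by rewrite addrC subrK.
by rewrite ube subrr addr0.
Qed.

(** * Finiteness of the energy and comparison of energies *)

Lemma within_continuous_comp {R : realType} (A : set R) (phi v : R -> R) :
  {within A, continuous v} -> continuous phi -> {within A, continuous (phi \o v)}.
Proof.
move=> /subspace_continuousP cv cphi; apply/subspace_continuousP => x xA.
exact: (cvg_comp _ _ (cv x xA) (cphi (v x))).
Qed.

(** Since [v] is continuous on a compact interval, [a \o v] is bounded and [b \o v] integrable,
    while [h ^+ 2] is integrable by admissibility. Energies are therefore finite and may be
    subtracted. *)
Lemma energy_integrable {R : realType} (a b : R -> R) (T : R) (v h : R -> R) :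
  0 <= T -> continuous a -> continuous b -> inUT T v h ->
  lebesgue_measure.-integrable `[0, T]
    (EFin \o (fun x => a (v x) * h x ^+ 2 + b (v x))).
Proof.
move=> T0 ca cb vh; have cv := inUT_continuous T v h T0 vh.
have cav : {within `[0, T], continuous (a \o v)}.
  exact: within_continuous_comp.
have cbv : {within `[0, T], continuous (b \o v)}.
  exact: within_continuous_comp.
have mav := subspace_continuous_measurable_fun (measurable_itv `[0, T]) cav.
have mbv := subspace_continuous_measurable_fun (measurable_itv `[0, T]) cbv.
have [mh [h2 _]] := vh.
have i2 := square_integrable T h mh h2.
have ibv : lebesgue_measure.-integrable `[0, T] (EFin \o (b \o v)).
  by apply: continuous_compact_integrable => //; exact: segment_compact.
have [M MP] : exists M, forall x, x \in `[0, T] -> `|a (v x)| <= M.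
  have cn : {within `[0, T], continuous (fun x => `|a (v x)|)}.
    by apply: (within_continuous_comp _ _ _ cav); exact: norm_continuous.
  have [c _ cP] := EVT_max T0 cn.
  by exists `|a (v c)|.
suff iav : lebesgue_measure.-integrable `[0, T]
    (EFin \o (fun x => a (v x) * h x ^+ 2)).
  by apply: (integrableD _ iav ibv).
apply: (le_integrable _ _ _ (integrableZl _ M i2)) => //.
  by apply/measurable_EFinP; apply: measurable_funM => //; exact: measurable_funX.
move=> x xT; suff : `|a (v x) * h x ^+ 2| <= `|M * h x ^+ 2| by rewrite -lee_fin.
rewrite !normrM ler_wpM2r// (le_trans (MP _ xT))//; exact: ler_norm.
Qed.

(** Integrate the pointwise inequality, bound the integral of [f1] by that of [f2], and cancel the
    latter, which is finite. In the application [f1] and [f2] are the energy densities of the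
    minimizer and of the competitor, [S] is where replacing the minimizer gains at least [d], and
    [E] is where it may cost up to [K]. *)
Lemma penalized_comparison {disp : measure_display} {X : measurableType disp}
    {R : realType} (mu : {measure set X -> \bar R}) (D S E : set X)
    (f1 f2 : X -> R) (d K : R) :
  measurable D -> measurable S -> measurable E ->
  (mu D < +oo)%E -> S `<=` D -> E `<=` D ->
  mu.-integrable D (EFin \o f1) ->
  mu.-integrable D (EFin \o f2) ->
  (forall x, D x -> f2 x + d * \1_S x <= f1 x + K * \1_E x) ->
  (\int[mu]_(x in D) (f1 x)%:E <=
   \int[mu]_(x in D) (f2 x)%:E)%E ->
  (d%:E * mu S <= K%:E * mu E)%E.
Proof.
move=> mD mS mE Doo SD ED i1 i2 f12 le12.
have ind (A : set X) : measurable A ->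
    mu.-integrable D (EFin \o (fun x => \1_A x)).
  move=> mA; apply: measurable_bounded_integrable => //.
    exact: measurable_indic.
  exists 1; split => // y y1 x _ /=; rewrite indicE (le_trans _ (ltW y1))//.
  by case: (_ \in _); rewrite ?normr1 ?normr0.
have indZ (A : set X) (r : R) : measurable A ->
    mu.-integrable D (EFin \o (fun x => r * \1_A x)).
  by move=> mA; apply: (integrableZl _ r (ind A mA)).
have intE (A : set X) (r : R) : measurable A -> A `<=` D ->
    (\int[mu]_(x in D) (EFin \o (fun x => r * \1_A x)%R) x =
     r%:E * mu A)%E.
  move=> mA AD; rewrite (integralZl _ (ind A mA))//; congr (_ * _)%E.
  rewrite -[in RHS](setIidl AD); exact: integral_indic.
have := le_integral mD (integrableD mD i2 (indZ S d mS))
  (integrableD mD i1 (indZ E K mE)) _.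
rewrite integralD//; [|exact: indZ]; rewrite integralD//; [|exact: indZ].
rewrite !intE// => H.
have {H} H : (\int[mu]_(x in D) (EFin \o f2) x + d%:E * mu S <=
  \int[mu]_(x in D) (EFin \o f1) x + K%:E * mu E)%E.
  by apply: H => x /set_mem xD; have := f12 x xD; rewrite -lee_fin.
have F2 : (\int[mu]_(x in D) (EFin \o f2) x)%E \is a fin_num.
  exact: integrable_fin_num.
rewrite -(leeD2lE _ _ F2).
by apply: (le_trans H); apply: leeD2r.
Qed.

(** * The trapezoidal competitor *)

Definition trapezoid {R : realType} (T z x : R) : R :=
  1 + (1 - z) * (Num.max 0 (x - (T - 1)) - Num.min x 1).

(** For [T >= 2] and [x] in [[0, T]], the [max] and [min] terms of [trapezoid] are the integrals
    over [[0, x]] of these two indicators, which makes membership in the admissible class a direct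
    computation. *)
Definition trapezoid_slope {R : realType} (T z x : R) : R :=
  (1 - z) * (\1_`[T - 1, T] x - \1_`[0, 1] x).

(** The integral is the length of the intersection of the two intervals; the outer [max] with 0
    covers the case where it is empty. *)
Lemma Rintegral_indic_itv {R : realType} (x s t : R) : 0 <= x ->
  Rintegral lebesgue_measure `[0, x] \1_`[s, t] =
  Num.max 0 (Num.min x t - Num.max 0 s).
Proof.
move=> x0.
have -> : Rintegral lebesgue_measure `[0, x] \1_`[s, t] =
    fine (lebesgue_measure (`[s, t]%classic `&` `[0, x])).
  by congr fine; exact: integral_indic.
rewrite (_ : _ `&` _ = `[Num.max 0 s, Num.min x t]%classic).
  rewrite lebesgue_measure_itv /= lte_fin.
  case: ifPn => [lt|]; first by apply/esym/max_r; rewrite subr_ge0 ltW.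
  by rewrite -leNgt => le; apply/esym/max_l; rewrite subr_le0.
apply/seteqP; split => y /=; rewrite !in_itv /= ge_max le_min.
  by move=> [/andP[-> ->] /andP[-> ->]].
by move=> /andP[/andP[-> ->] /andP[-> ->]].
Qed.

Lemma trapezoid_inUT {R : realType} (T z : R) : 2 <= T ->
  inUT T (trapezoid T z) (trapezoid_slope T z).
Proof.
move=> T2.
have mI (A : set R) : measurable A -> measurable_fun `[0, T] (\1_A : R -> R).
  by move=> mA; exact: measurable_indic.
have mk : measurable_fun `[0, T] (trapezoid_slope T z).
  by apply: measurable_funM => //; apply: measurable_funB; exact: mI.
have bnd x : `|\1_`[T - 1, T] x - \1_`[0, 1] x| <= 1 :> R.
  rewrite !indicE; case: (_ \in _); case: (_ \in _);
    by rewrite /= ?subrr ?subr0 ?sub0r ?normrN ?normr1 ?normr0.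
split=> //; split.
  have /integrableP[_] : lebesgue_measure.-integrable `[0, T]
     (EFin \o (fun x => trapezoid_slope T z x ^+ 2)).
    apply: (le_integrable _ _ _ (itv_integrable_cst 0 T ((1 - z) ^+ 2))) => //.
      by apply/measurable_EFinP; exact: measurable_funX.
    move=> x _.
    suff : `|trapezoid_slope T z x ^+ 2| <= `|(1 - z) ^+ 2| by rewrite -lee_fin.
    rewrite !normrX lerXn2r// ?nnegrE ?normr_ge0// normrM.
    by rewrite ler_piMr.
  by under eq_integral do rewrite /= ger0_norm ?sqr_ge0//.
split; last first.
  rewrite /trapezoid max_r ?min_r; lra.
move=> x /andP[x0 xT]; congr (1 + _).
have iI (s t : R) : lebesgue_measure.-integrable `[0, x] (EFin \o (\1_`[s, t] : R -> R)).
  apply: (le_integrable _ _ _ (itv_integrable_cst 0 x 1)) => //.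
    by apply/measurable_EFinP; exact: measurable_indic.
  move=> y _; suff : `|(\1_`[s, t] y : R)| <= `|1| by rewrite -lee_fin.
  by rewrite indicE; case: (_ \in _); rewrite /= ?normr1 ?normr0.
rewrite /trapezoid_slope RintegralZl//; last first.
  exact: (integrableB _ (iI _ _) (iI _ _)).
rewrite RintegralB// !Rintegral_indic_itv//.
rewrite (min_l _ : Num.min x T = x)// (max_r _ : Num.max 0 (T - 1) = _); last by lra.
rewrite (max_l (lexx 0)) subr0 (max_r _ : Num.max 0 (Num.min x 1) = _)//.
by rewrite le_min x0 ler01.
Qed.

Lemma trapezoid_itv {R : realType} (T z x : R) :
  2 <= T -> z <= 1 -> 0 <= x <= T -> z <= trapezoid T z x <= 1.
Proof.
move=> T2 z1 /andP[x0 xT]; rewrite /trapezoid.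
have : -1 <= Num.max 0 (x - (T - 1)) - Num.min x 1 <= 0.
  by case: (leP 0 (x - (T - 1))) => ?; case: (leP x 1) => ?; apply/andP; split; lra.
move: (_ - _) => r /andP[r1 r0]; apply/andP; split; nra.
Qed.

Lemma trapezoid_mid {R : realType} (T z x : R) :
  1 <= x -> x <= T - 1 -> trapezoid T z x = z.
Proof.
by move=> x1 xT; rewrite /trapezoid max_l ?subr_le0// min_r//; lra.
Qed.

Lemma trapezoid_slope_mid {R : realType} (T z x : R) :
  1 < x -> x < T - 1 -> trapezoid_slope T z x = 0.
Proof.
move=> x1 xT; rewrite /trapezoid_slope !indicE !mem_setE !in_itv /=.
by rewrite [x <= 1]leNgt x1 andbF [T - 1 <= x]leNgt xT /= subrr mulr0.
Qed.

Lemma trapezoid_slope_sqr {R : realType} (T z x : R) :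
  trapezoid_slope T z x ^+ 2 <= (1 - z) ^+ 2.
Proof.
by rewrite /trapezoid_slope exprMn ler_piMr ?sqr_ge0.
Qed.

(** * Excursions of a minimizer above the trapezoid *)

Definition trapezoid_ramps {R : realType} (T : R) : set R :=
  `[0, 1] `|` `[T - 1, T].

(** Splice the trapezoid into [u] on [[al, be]] and compare densities. Off the ramps the new density
    is [b z], while the old one is at least [b (u x)], hence at least [b z], and exceeds it by [dl]
    on the superlevel set. On the ramps the new density is at most [K] and the old one at least [m];
    the further [dl] in the constant absorbs the superlevel indicator there. *)
Lemma excursion_bound {R : realType} (a b u g : R -> R) (z T al be dl m K : R) :
  continuous a -> continuous b -> (forall x, 0 < a x) ->
  2 <= T -> z <= 1 -> 0 <= dl -> (forall y, z <= y -> b z <= b y) ->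
  (forall x, m <= b x) ->
  (forall y, z <= y <= 1 -> a y * (1 - z) ^+ 2 + b y <= K) ->
  inUT T u g ->
  (forall v h, inUT T v h -> (FT a b T u g <= FT a b T v h)%E) ->
  0 <= al -> al <= be -> be <= T ->
  u al = trapezoid T z al -> u be = trapezoid T z be ->
  (forall x, al <= x <= be -> trapezoid T z x <= u x) ->
  measurable (`[al, be] `&` [set x | (b z + dl <= b (u x))%R]) /\
  (dl%:E * lebesgue_measure (`[al, be] `&` [set x | (b z + dl <= b (u x))%R]) <=
   (K - m + dl)%:E *
     lebesgue_measure (`[al, be] `&` trapezoid_ramps T))%E.
Proof.
move=> ca cb a0 T2 z1 dl0 bz mb KP ug umin al0 albe beT ual ube wu.
have T0 : 0 <= T by lra.
have sI : `[al, be] `<=` `[0, T] by apply: subset_itv; rewrite bnd_simp.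
have wk := trapezoid_inUT T z T2.
have vh := inUT_splice _ _ _ _ _ _ _ al0 albe beT ug wk ual ube.
have i1 := energy_integrable a b T _ _ T0 ca cb ug.
have i2 := energy_integrable a b T _ _ T0 ca cb vh.
set S := _ `&` [set _ | _]; set E := _ `&` trapezoid_ramps T.
have mS : measurable S.
  have cbu : {within `[0, T], continuous (b \o u)}.
    by apply: within_continuous_comp => //; exact: inUT_continuous ug.
  have mbu : measurable_fun `[0, T] (b \o u).
    exact: subspace_continuous_measurable_fun.
  have mbu' : measurable_fun `[al, be] (b \o u) by exact: measurable_funS mbu.
  rewrite (_ : S = `[al, be] `&` (b \o u) @^-1` `[b z + dl, +oo[).
    exact: mbu'.
  apply/seteqP; split => x [xI]; rewrite /= in_itv /= ?andbT => bx;
    by split => //=; rewrite in_itv /= andbT.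
have mE : measurable E by apply: measurableI => //; exact: measurableU.
split => //.
apply: (penalized_comparison lebesgue_measure `[0, T] S E _ _ dl (K - m + dl)
  _ _ _ _ _ _ i1 i2) => //.
- by apply: compact_finite_measure; exact: segment_compact.
- by move=> x [/sI].
- by move=> x [/sI].
- move=> x; rewrite /= in_itv /= => xT.
  (* Outside [[al, be]] the two densities coincide and both indicators vanish. *)
  have [xI|xI] := boolP (al <= x <= be); last first.
    rewrite !indicE !memNset ?mulr0//.
      by move=> [] /=; rewrite in_itv /= (negbTE xI).
    by move=> [] /=; rewrite in_itv /= (negbTE xI).
  have wx := wu x xI; have w01 := trapezoid_itv T z x T2 z1 xT.
  have zu : z <= u x by case/andP: w01 => zw _; exact: le_trans zw wx.
  have ag : 0 <= a (u x) * g x ^+ 2 by rewrite mulr_ge0 ?sqr_ge0// ltW.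
  have [xE|xE] := pselect (`[0, 1]%classic x \/ `[T - 1, T]%classic x).
    have -> : \1_E x = 1 :> R by rewrite indicE mem_set//; split => //; rewrite /= in_itv.
    have S1 : dl * \1_S x <= dl.
      by rewrite indicE; case: (_ \in _); rewrite ?mulr1 ?mulr0.
    have aw : a (trapezoid T z x) * trapezoid_slope T z x ^+ 2 <=
              a (trapezoid T z x) * (1 - z) ^+ 2.
      by rewrite ler_wpM2l ?trapezoid_slope_sqr// ltW.
    have := KP _ w01; have := mb (u x); lra.
  have [x1 xT1] : 1 < x /\ x < T - 1.
    split; rewrite ltNge; apply/negP => xx; apply: xE; [left|right];
    by rewrite /= in_itv /= xx ?andbT; case/andP: xT.
  rewrite trapezoid_slope_mid// (trapezoid_mid _ _ _ (ltW x1) (ltW xT1)) expr0n mulr0 add0r.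
  (* The constant is nonnegative: the bound by [K], taken at [z], gives [m <= b z <= K]. *)
  have E0 : 0 <= (K - m + dl) * \1_E x.
    rewrite mulr_ge0//.
    have := KP z; have := mb z; have := a0 z; rewrite lexx z1 => az bz' /(_ isT).
    by have := mulr_ge0 (ltW az) (sqr_ge0 (1 - z)); lra.
  have [xS|xS] := pselect (S x).
    rewrite [\1_S x]indicE mem_set// mulr1.
    case: xS => _ /= xS; lra.
  rewrite [\1_S x]indicE memNset// mulr0.
  by have bzu := bz _ zu; lra.
- exact: umin.
Qed.

(** In the bound, 2 accounts for the two unit ramps. Each of the at most two excursions through [1]
    or [T - 1] contributes [2 * ((K - m + dl) / dl)], by [excursion_bound] and the fact that the
    ramps have measure at most 2. *)
Lemma superlevel_measure_bound {R : realType} (a b u g : R -> R) (z T dl m K : R) :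
  continuous a -> continuous b -> (forall x, 0 < a x) ->
  2 <= T -> z <= 1 -> 0 < dl -> (forall y, z <= y -> b z <= b y) ->
  (forall x, m <= b x) ->
  (forall y, z <= y <= 1 -> a y * (1 - z) ^+ 2 + b y <= K) ->
  inUT T u g ->
  (forall v h, inUT T v h -> (FT a b T u g <= FT a b T v h)%E) ->
  exists2 M : set R, measurable M /\
     (lebesgue_measure M <= (2 + 4 * ((K - m + dl) / dl))%:E)%E &
   forall x, 0 <= x <= T -> z < u x -> b z + 2 * dl <= b (u x) -> M x.
Proof.
move=> ca cb a0 T2 z1 dl0 bz mb KP ug umin.
have T0 : 0 <= T by lra.
have wk := trapezoid_inUT T z T2.
pose p x := u x - trapezoid T z x.
have cu := inUT_continuous T u g T0 ug.
have cp : {within `[0, T], continuous p}.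
  apply/subspace_continuousP => x xT; apply: cvgB.
    by move/subspace_continuousP : cu; apply.
  by move/subspace_continuousP : (inUT_continuous T _ _ T0 wk); apply.
have p0 : p 0 = 0.
  by rewrite /p (inUT_left T _ _ T0 ug) (inUT_left T _ _ T0 wk) subrr.
have pT : p T = 0.
  by case: ug => _ [_ [_ uT]]; case: wk => _ [_ [_ wT]]; rewrite /p uT wT subrr.
(* Half of the gap [2 * dl] is given up here: a point with [b z + 2 * dl <= b (u x)] then has a
   whole neighbourhood in [[0, T]] inside [S]. *)
pose S := [set x | (b z + dl <= b (u x))%R].
pose E : set R := trapezoid_ramps T.
have mE : measurable E by exact: measurableU.
have KK : 0 <= K - m + dl.
  have := KP z; have := mb z; have := a0 z; rewrite lexx z1 => az bz' /(_ isT).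
  by have := mulr_ge0 (ltW az) (sqr_ge0 (1 - z)); lra.
have exc al be : 0 <= al -> al <= be -> be <= T -> p al = 0 -> p be = 0 ->
    (forall x, al < x < be -> 0 < p x) ->
    measurable (`[al, be] `&` S) /\
    (dl%:E * lebesgue_measure (`[al, be] `&` S) <=
      (K - m + dl)%:E * lebesgue_measure (`[al, be] `&` E))%E.
  move=> al0 albe beT pal pbe pos.
  apply: (excursion_bound a b u g z T al be dl m K) => //.
  - exact: ltW.
  - by apply/eqP; rewrite -subr_eq0; apply/eqP.
  - by apply/eqP; rewrite -subr_eq0; apply/eqP.
  move=> x /andP[]; rewrite le_eqVlt => /predU1P[<- _|ax].
    by rewrite -subr_ge0 -/(p al) pal.
  rewrite le_eqVlt => /predU1P[->|xb]; first by rewrite -subr_ge0 -/(p be) pbe.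
  by rewrite -subr_ge0 ltW// pos// ax.
have comp y : 0 <= y <= T -> 0 < p y -> exists al be, [/\ 0 <= al < y, y < be <= T,
    p al = 0, p be = 0 & forall x, al < x < be -> 0 < p x].
  move=> yT py.
  have [al al1 [pal posl]] := last_zero_before T y p cp p0 yT py.
  have [be be1 [pbe posr]] := first_zero_after T y p cp pT yT py.
  exists al, be; split => // x /andP[ax xb].
  have [xy|yx] := leP x y; first by apply: posl; rewrite ax.
  by apply: posr; rewrite xb ltW.
have muE : (lebesgue_measure E <= 2%:E)%E.
  pose I := `[0 : R, 1]%classic; pose J := `[T - 1, T]%classic.
  have : (lebesgue_measure E <= lebesgue_measure I + lebesgue_measure J)%E.
    exact: measureU2.
  rewrite !lebesgue_measure_itv /= !lte_fin ltr01 ifT; last by lra.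
  by move=> /le_trans; apply; rewrite -!EFinB -EFinD lee_fin; lra.
(* The positivity condition says that [x] lies in the component of [y]. If [p y <= 0] there is no
   such component and [M] is empty; otherwise [M] is the part of [S] in its closure. *)
have cover y : 0 <= y <= T -> exists2 M : set R, measurable M /\
    (lebesgue_measure M <= (2 * ((K - m + dl) / dl))%:E)%E &
    forall x, 0 <= x <= T -> S x ->
      (forall t, Num.min x y <= t <= Num.max x y -> 0 < p t) -> M x.
  move=> yT; have [py|py] := ltP 0 (p y); last first.
    exists set0.
      split => //; rewrite measure0 lee_fin mulr_ge0// divr_ge0// ltW//.
    move=> x xT Sx /(_ y); rewrite ge_min lexx orbT le_max lexx orbT => /(_ isT).
    by rewrite ltNge py.
  have [al [be [/andP[al0 aly] /andP[ybe beT] pal pbe pos]]] := comp y yT py.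
  have [mM leM] := exc al be al0 (ltW (lt_trans aly ybe)) beT pal pbe pos.
  exists (`[al, be] `&` S).
    split => //.
    have : (dl%:E * lebesgue_measure (`[al, be] `&` S) <=
            dl%:E * (2 * ((K - m + dl) / dl))%:E)%E.
      apply: (le_trans leM).
      rewrite -EFinM (_ : dl * _ = (K - m + dl) * 2); last by field; rewrite gt_eqF.
      rewrite EFinM lee_wpmul2l//.
      apply: le_trans muE; apply: le_measure; rewrite ?inE//.
      exact: measurableI.
    by rewrite lee_pmul2l.
  move=> x /andP[x0 xT] Sx xpos; split => //=; rewrite in_itv /=.
  apply/andP; split; rewrite leNgt; apply/negP => H.
    suff /xpos : Num.min x y <= al <= Num.max x y by rewrite pal ltxx.
    by rewrite ge_min (ltW H) le_max (ltW aly) orbT.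
  suff /xpos : Num.min x y <= be <= Num.max x y by rewrite pbe ltxx.
  by rewrite ge_min (ltW ybe) le_max (ltW H) orbT.
have T1 : 0 <= (1 : R) <= T by rewrite ler01 /=; lra.
have T1' : 0 <= T - 1 <= T by apply/andP; split; lra.
have [M1 [mM1 leM1] M1P] := cover 1 T1.
have [M2 [mM2 leM2] M2P] := cover (T - 1) T1'.
exists (E `|` (M1 `|` M2)).
  split; first by apply: measurableU => //; exact: measurableU.
  apply: (le_trans (measureU2 _ _ _)) => //; first exact: measurableU.
  rewrite EFinD; apply: leeD => //.
  apply: (le_trans (measureU2 _ _ _)) => //.
  rewrite (_ : 4 * _ = 2 * ((K - m + dl) / dl) + 2 * ((K - m + dl) / dl)); last by lra.
  by rewrite EFinD; exact: leeD.
move=> x xT zx bx.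
(* Points on the ramps go into [E]. Any other [x] has a component [(al, be)]: it contains [1] if
   [al < 1], and [T - 1] if [T - 1 < be]; the remaining case is contradictory. *)
have [[x1 xT1]|xE] := pselect (1 < x /\ x < T - 1); last first.
  left; have [x1|x1] := leP x 1; [left|right].
    by rewrite /= in_itv /= x1; case/andP: xT => ->.
  rewrite /= in_itv /=; case/andP: xT => _ ->; rewrite andbT leNgt.
  by apply/negP => xx; apply: xE.
right.
have Sx : S x by rewrite /S /=; lra.
have px : 0 < p x by rewrite /p (trapezoid_mid _ _ _ (ltW x1) (ltW xT1)) subr_gt0.
have [al [be [/andP[al0 alx] /andP[xbe beT] pal pbe pos]]] := comp x xT px.
have [al1|al1] := ltP al 1.
  left; apply: M1P => // t; rewrite (min_r (ltW x1)) (max_l (ltW x1)) => /andP[t1 tx].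
  by apply: pos; rewrite (lt_le_trans al1 t1) (le_lt_trans tx xbe).
have [be1|be1] := ltP (T - 1) be.
  right; apply: M2P => // t; rewrite (min_l (ltW xT1)) (max_r (ltW xT1)) => /andP[t1 tx].
  by apply: pos; rewrite (lt_le_trans alx t1) (le_lt_trans tx be1).
(* The component avoids the ramps up to a null set, yet continuity of [b \o u]
   at [x] gives it a nondegenerate interval of superlevel points. *)
exfalso.
have [mM leM] := exc al be al0 (ltW (lt_trans alx xbe)) beT pal pbe pos.
have E0 : lebesgue_measure (`[al, be] `&` E) = 0.
  apply: (@subset_measure0 _ _ _ lebesgue_measure _ ([set 1] `|` [set T - 1])).
  - exact: measurableI.
  - exact: measurableU.
  - move=> t [/=]; rewrite in_itv /= => /andP[at_ tb] [] /=; rewrite in_itv /= => /andP[h1 h2].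
      by left; apply/eqP; rewrite eq_le h2 (le_trans al1 at_).
    by right; apply/eqP; rewrite eq_le h1 (le_trans tb be1).
  - apply/eqP; rewrite eq_le measure_ge0 andbT.
    have : (lebesgue_measure ([set 1%R] `|` [set (T - 1)%R]) <=
        lebesgue_measure [set 1%R] + lebesgue_measure [set (T - 1)%R])%E.
      exact: measureU2.
    by rewrite !lebesgue_measure_set1 adde0.
move: leM; rewrite E0 mule0 => leM.
have cbu : {within `[0, T], continuous (b \o u)} by exact: within_continuous_comp.
have [r r0 rP] := within_continuous_dist _ _ cbu x xT dl dl0.
pose s := Num.min be (x + r / 2).
have xs : x < s by rewrite lt_min xbe; lra.
have sbe : s <= be by rewrite ge_min lexx.
have sr : s <= x + r / 2 by rewrite ge_min lexx orbT.
have sub : `[x, s] `<=` `[al, be] `&` S.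
  move=> t /=; rewrite in_itv /= => /andP[xt ts]; split.
    by rewrite in_itv /= (le_trans (ltW alx) xt) (le_trans ts sbe).
  have tT : 0 <= t <= T.
    by rewrite (le_trans _ xt) ?(le_trans ts)// ?(le_trans sbe)//; case/andP: xT.
  have /(rP t tT) : `|x - t| < r by rewrite ler0_norm ?subr_le0//; lra.
  by rewrite /S /= ltr_norml => /andP[]; lra.
have : (lebesgue_measure `[x, s]%classic <= lebesgue_measure (`[al, be] `&` S))%E.
  by apply: le_measure; rewrite ?inE.
rewrite lebesgue_measure_itv /= lte_fin xs => pos1.
have : (dl%:E * (s%:E - x%:E) <= 0)%E.
  by apply: le_trans leM; rewrite lee_wpmul2l// lee_fin ltW.
rewrite -EFinB -EFinM lee_fin leNgt => /negP; apply.
by rewrite mulr_gt0// subr_gt0.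
Qed.

(** * Choice of the resting level and conclusion *)

Lemma C1_continuous {R : realType} (f : R -> R) : C1 f -> continuous f.
Proof.
by move=> [df _] x; apply: differentiable_continuous; exact/derivable1_diffP.
Qed.

(** Some [z0] has [b z0 < B], which forces [z0 < ubar]. A minimizer [z] of [b] on the compact
    [[z0, ubar]] stays below [B], hence below every value of [b] beyond [ubar], and so minimizes [b]
    on the whole half-line from [z]. The gap [B - b z] is written [2 * dl]. *)
Lemma exists_below_argmin {R : realType} (b : R -> R) (ubar : R) :
  continuous b -> (exists m : R, forall x, m <= b x) ->
  inf (range b) < inf [set b x | x in [set y | ubar <= y]] ->
  exists z dl : R, [/\ z < ubar, 0 < dl, forall y, z <= y -> b z <= b y &
    forall y, ubar <= y -> b z + 2 * dl <= b y].
Proof.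
move=> cb [m mb]; set B := inf [set b x | x in [set y | ubar <= y]] => binf.
have Bb y : ubar <= y -> B <= b y.
  move=> uy; apply: ge_inf; last by exists y.
  by exists m => _ [x _ <-].
have hI : has_inf (range b).
  by split; [exists (b 0), 0|exists m => _ [x _ <-]].
have gap : 0 < B - inf (range b) by rewrite subr_gt0.
have [_ [z0 _ <-]] := inf_adherent gap hI.
rewrite addrC subrK => bz0.
have z0u : z0 < ubar.
  by rewrite ltNge; apply/negP => /Bb; rewrite leNgt bz0.
have [z] := EVT_min (ltW z0u) (continuous_subspaceT cb).
rewrite in_itv /= => /andP[z0z zu] zmin.
have bzB : b z < B.
  by apply: le_lt_trans bz0; apply: zmin; rewrite in_itv /= lexx ltW.
exists z, ((B - b z) / 2); split.
- by rewrite ltNge; apply/negP => /Bb; rewrite leNgt bzB.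
- by lra.
- move=> y zy; have [yu|uy] := leP y ubar.
    by apply: zmin; rewrite in_itv /= yu (le_trans z0z).
  by apply: ltW; apply: (lt_le_trans bzB); apply: Bb; exact: ltW.
- by move=> y /Bb By; lra.
Qed.

Theorem mainTheorem2 (R : realType) (a b : R -> R) (ubar : R)
  (Ca : C1 a) (Cb : C1 b) (apos : forall x, 0 < a x)
  (hubar : ubar < 1)
  (bbdd : exists m : R, forall x, m <= b x)
  (binf : inf (range b) < inf [set b x | x in [set y | ubar <= y]])
  (u : R -> R -> R)
  (umin : forall T : R, 0 < T -> minimizerFT a b T (u T)) :
  exists c : R, 0 < c /\
    forall T : R, 0 < T ->
      (lebesgue_measure [set x : R | (0 <= x <= T)%R /\ (ubar <= u T x)%R]
        <= (c * (1 + Num.sqrt T))%:E)%E.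
Proof.
have ca := C1_continuous _ Ca; have cb := C1_continuous _ Cb.
have [z [dl [zu dl0 bz bu]]] := exists_below_argmin _ _ cb bbdd binf.
have [m mb] := bbdd.
have z1 : z <= 1 by exact: ltW (lt_trans zu hubar).
(* This function of the height [y] is the energy density on a ramp of slope [1 - z] in absolute
   value; its maximum over [[z, 1]] is the [K] of the excursion estimate and does not depend on
   [T]. *)
have cK : continuous (fun y => a y * (1 - z) ^+ 2 + b y).
  move=> y; apply: cvgD; last exact: cb.
  by apply: cvgM; [exact: ca|exact: cvg_cst].
have [y0 _ y0max] := EVT_max z1 (continuous_subspaceT cK).
pose K := a y0 * (1 - z) ^+ 2 + b y0.
have KP y : z <= y <= 1 -> a y * (1 - z) ^+ 2 + b y <= K.
  by move=> yI; apply: y0max; rewrite in_itv.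
have mK : m <= K.
  have azz := mulr_ge0 (ltW (apos z)) (sqr_ge0 (1 - z)).
  by apply: le_trans (KP z _); rewrite ?lexx//; have := mb z; lra.
pose c := 2 + 4 * ((K - m + dl) / dl).
have c2 : 2 <= c by rewrite lerDl mulr_ge0// divr_ge0// ?ltW//; lra.
exists c; split; first by lra.
move=> T T0.
(* The measure is in fact bounded by the constant [c], which is stronger than the claimed growth. *)
have cT : c <= c * (1 + Num.sqrt T).
  by rewrite ler_peMr ?lerDl ?sqrtr_ge0//; lra.
have [g [ug gmin]] := umin T T0.
set X := [set _ | _].
have mX : measurable X.
  have mu : measurable_fun `[0, T] (u T).
    apply: subspace_continuous_measurable_fun => //.
    exact: inUT_continuous (ltW T0) ug.
  rewrite (_ : X = `[0, T] `&` u T @^-1` `[ubar, +oo[); first exact: mu.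
  by apply/seteqP; split => x; rewrite /X /= !in_itv /= andbT.
(* Two unit ramps fit into [[0, T]] without overlap exactly when [T >= 2]. For shorter intervals the
   whole length [T < 2 <= c] suffices. *)
have [T2|T2] := leP 2 T.
  have [M [mM leM] MP] := superlevel_measure_bound a b (u T) g z T dl m K
    ca cb apos T2 z1 dl0 bz mb KP ug gmin.
  apply: (@le_trans _ _ (lebesgue_measure M)).
    apply: le_measure; rewrite ?inE// => x [xT ux].
    by apply: MP => //; [exact: lt_le_trans zu ux|exact: bu].
  by apply: (le_trans leM); rewrite lee_fin.
have : (lebesgue_measure X <= lebesgue_measure `[0%R, T]%classic)%E.
  by apply: le_measure; rewrite ?inE// => x [xT _]; rewrite /= in_itv.
rewrite lebesgue_measure_itv /= lte_fin T0 oppr0 adde0 => /le_trans; apply.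
by rewrite lee_fin; lra.
Qed.
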